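(* Let $0\le k\le n<\infty$ be integers and let $m_1\ge m_2$ be integers such that the complex algebra $A=\mathrm{IDD}(K^k_n,m_1,m_2)$ has nonzero multiplication. If its level $\mathrm{lev}(A)=m_1+m_2$ satisfies $2k-n\le m_1+m_2<k$, then $A$ is nilpotent.
   Context: For an integer $m$ and an integer $i\ge 0$ put $c_m(i)=\frac{i!}{(i-m)!}$ if $i\ge m$ and $c_m(i)=0$ if $i<m$ (so $T^m(x^i)=c_m(i)x^{i-m}$, where $T^m$ is the $m$-th derivative for $m>0$, the identity for $m=0$, and the $|m|$-fold iterate of $\int x^i=\frac{1}{i+1}x^{i+1}$ for $m<0$). The algebra $\mathrm{IDD}(K^k_n,m_1,m_2)$ is the complex algebra with basis $e_k,e_{k+1},\ldots,e_n$ and bilinear multiplication $e_i\diamond e_j=c_{m_1}(i)\,c_{m_2}(j)\,e_{i+j-m_1-m_2}$ if $k\le i+j-m_1-m_2\le n$, and $e_i\diamond e_j=0$ otherwise. Its level is $m_1+m_2$. A (non-associative) algebra $A$ is nilpotent if $A^{t}=0$ for some $t$, where $A^1=A$ and $A^{t}=\sum_{i+j=t}A^{i}\diamond A^{j}$ ($i,j\ge1$). *)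

(* Defs.v *)
From HB Require Import structures.
From mathcomp Require Import all_boot all_order all_algebra.
From mathcomp Require Import reals complex.

Set Implicit Arguments.
Unset Strict Implicit.
Unset Printing Implicit Defensive.

Import Order.TTheory GRing.Theory Num.Theory.
Local Open Scope ring_scope.

(* A finite-dimensional non-associative algebra is a [vectType V] together with
   a bilinear multiplication [mul] on it. *)
Section NonAssocAlgebra.

Variables (F : fieldType) (V : vectType F) (mul : {bilinear V -> V -> V}).

(* The span of all products of an element of U by an element of W. As for
   [prodv] in falgebra, it is computed on bases; [mem_prod_vs] and
   [prod_vs_sub] show that the choice of the bases is irrelevant. *)
Definition prod_vs (U W : {vspace V}) : {vspace V} :=
  <<[seq mul u w | u <- vbasis U, w <- vbasis W]>>%VS.

Lemma mem_prod_vs (U W : {vspace V}) u w :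
  u \in U -> w \in W -> mul u w \in prod_vs U W.
Proof.
move=> uU wW; rewrite (coord_vbasis uU) (coord_vbasis wW).
rewrite linear_sumlz memv_suml // => i _; rewrite linearZl_LR memvZ //.
rewrite linear_sumr memv_suml // => j _; rewrite linearZr_LR memvZ //.
by apply: memv_span; apply: allpairs_f; apply: mem_nth; rewrite size_tuple.
Qed.

Lemma prod_vs_sub (U W X : {vspace V}) :
  (forall u w, u \in U -> w \in W -> mul u w \in X) -> (prod_vs U W <= X)%VS.
Proof.
move=> h; apply/span_subvP => _ /allpairsP[[u w] /= [uU wW ->]].
by apply: h; apply: vbasis_mem.
Qed.

(* The sequence A^1, ..., A^t. *)
Fixpoint alg_powers (t : nat) : seq {vspace V} :=
  if t is t'.+1 then
    let s := alg_powers t' in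
    rcons s (if t' is 0 then fullv
             else \sum_(i < t') prod_vs (nth 0%VS s i)
                                        (nth 0%VS s (t'.-1 - i)))%VS
  else [::].

(* Only meaningful for t >= 1; see [alg_power1] and [alg_powerE]. *)
Definition alg_power (t : nat) : {vspace V} := nth 0%VS (alg_powers t) t.-1.

Lemma size_alg_powers t : size (alg_powers t) = t.
Proof. by elim: t => //= t IHt; rewrite size_rcons IHt. Qed.

Lemma nth_alg_powers t i :
  (i < t)%N -> nth 0%VS (alg_powers t) i = alg_power i.+1.
Proof.
elim: t => // t IHt; rewrite ltnS leq_eqVlt => /orP[/eqP-> // | lt_it].
by rewrite -IHt //= nth_rcons size_alg_powers lt_it.
Qed.

Lemma alg_power1 : alg_power 1 = fullv.
Proof. by []. Qed.

Lemma alg_powerE t : (1 < t)%N ->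
  alg_power t = (\sum_(1 <= i < t) prod_vs (alg_power i) (alg_power (t - i)))%VS.
Proof.
case: t => [|[|t]] // _; rewrite big_add1 /= big_mkord.
rewrite {1}/alg_power; set s := alg_powers t.+1.
have -> : alg_powers t.+2 = rcons s (\sum_(i < t.+1)
  prod_vs (nth 0%VS s i) (nth 0%VS s (t - i)))%VS by [].
rewrite nth_rcons size_alg_powers ltnn eqxx; apply: eq_bigr => i _.
rewrite !nth_alg_powers ?ltnS ?leq_subr //.
  by rewrite subSS subSn -1?ltnS.
by rewrite -ltnS.
Qed.

Definition nilpotent_alg : Prop :=
  exists t : nat, (0 < t)%N /\ alg_power t = 0%VS.

Definition nonzero_mul : Prop := exists u v : V, mul u v != 0.

End NonAssocAlgebra.

Section IDD.

Variables (F : numFieldType) (k n : nat) (m1 m2 : int).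

Definition idd_coef (m : int) (i : nat) : F :=
  if m <= i%:Z then i`!%:R / (`|i%:Z - m|%N)`!%:R else 0.

(* For k <= n, the carrier of IDD(K^k_n, m1, m2): coordinate number i is the
   coordinate along e_(k + i). *)
Definition idd : Type := 'rV[F]_(n - k).+1.
HB.instance Definition _ := Vector.on idd.

(* e_p if k <= p <= n, and 0 for the other integers p. *)
Definition idd_e (p : int) : idd :=
  if k%:Z <= p <= n%:Z then delta_mx 0 (inord (`|p|%N - k)) else 0.

(* The bilinear extension of
   (e_i, e_j) |-> c_{m1}(i) c_{m2}(j) e_{i + j - m1 - m2}; see [idd_mul_e]. *)
Definition idd_mul (u v : idd) : idd :=
  \sum_(i < (n - k).+1) \sum_(j < (n - k).+1)
    (u 0 i * v 0 j) *: ((idd_coef m1 (k + i) * idd_coef m2 (k + j))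
      *: idd_e ((k + i)%:Z + (k + j)%:Z - m1 - m2)).

Lemma idd_mul_is_bilinear : bilinear_for *:%R *:%R idd_mul.
Proof.
split=> w a u v; rewrite /= /idd_mul scaler_sumr -big_split;
  apply: eq_bigr => i _; rewrite /= scaler_sumr -big_split;
  apply: eq_bigr => j _; rewrite /= [in RHS](scalerA a) -scalerDl !mxE.
  by rewrite mulrDl mulrA.
by congr (_ *: _); rewrite mulrDr mulrCA.
Qed.

HB.instance Definition _ :=
  bilinear_isBilinear.Build F idd idd idd *:%R *:%R idd_mul idd_mul_is_bilinear.

Lemma idd_mul_e (i j : nat) : (k <= i <= n)%N -> (k <= j <= n)%N ->
  idd_mul (idd_e i) (idd_e j) =
  (idd_coef m1 i * idd_coef m2 j) *: idd_e (i%:Z + j%:Z - m1 - m2).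
Proof.
move=> /andP[ki iN] /andP[kj jN]; rewrite /idd_mul.
rewrite (bigD1 (inord (i - k))) //= (bigD1 (inord (j - k))) //=.
rewrite /idd_e !lez_nat ki iN kj jN /= !inordK ?ltnS ?leq_sub2r // !subnKC //.
rewrite !mxE !eqxx mulr1 scale1r big1 ?addr0 => [|l nl]; last first.
  by rewrite !mxE (negPf nl) mulr0 scale0r.
rewrite big1 ?addr0 // => l nl; rewrite big1 // => l' _.
by rewrite !mxE (negPf nl) mul0r scale0r.
Qed.

End IDD.

(* Main.v *)
Require Import Defs.
From mathcomp Require Import all_boot all_order all_algebra.
From mathcomp Require Import reals complex.
From mathcomp Require Import zify.

Import Order.TTheory GRing.Theory Num.Theory.
Local Open Scope ring_scope.

(** Put L = m1 + m2 and give e_p the degree p - L. The product of e_i and e_j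
    is a multiple of e_(i + j - L), and (i + j - L) - L = (i - L) + (j - L), so
    this shifted degree turns the multiplication into a graded one. Since
    L < k, every basis element has degree at least 1, hence A^t lives in degrees
    at least t ([alg_power_sub_filtration] applied to [deg_ge], with
    [deg_ge_mul] for the products). Degrees are bounded above by n - L, so A^t
    vanishes as soon as t > n - L. *)

Section Filtration.

Variables (F : fieldType) (V : vectType F) (mul : {bilinear V -> V -> V}).

(** The powers A^t form the smallest multiplicative filtration that starts
    with the whole algebra. *)
Lemma alg_power_sub_filtration (W : nat -> {vspace V}) :
    (fullv <= W 1)%VS ->
    (forall a b u v, u \in W a -> v \in W b -> mul u v \in W (a + b)%N) ->
  forall t, (0 < t)%N -> (alg_power mul t <= W t)%VS.
Proof.
move=> W1 Wmul; elim/ltn_ind=> t IHt t_gt0.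
case: (ltnP 1 t) => [t_gt1 | t_le1]; last first.
  by have -> : t = 1%N by lia.
rewrite alg_powerE // big_nat.
apply: (big_ind (fun U => U <= W t)%VS) => [|U U' UW U'W|i /andP[i_gt0 lt_it]].
- exact: sub0v.
- by rewrite subv_add UW.
apply: prod_vs_sub => u v u_i v_ti; rewrite -(subnKC (ltnW lt_it)).
apply: Wmul; first exact: subvP (IHt i lt_it i_gt0) _ u_i.
by apply: subvP _ _ v_ti; apply: IHt; lia.
Qed.

End Filtration.

Section ShiftedDegree.

Variables (F : numFieldType) (k n : nat) (m1 m2 : int).

Local Notation A := (idd F k n).
Local Notation L := (m1 + m2).

(** The span of the e_p with p - L >= t, as the kernel of the projection onto
    the remaining coordinates, so that membership is a coordinatewise test. *)
Definition deg_ge (t : nat) : {vspace A} :=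
  lker (linfun (mulmxr (diag_mx
    (\row_(i < (n - k).+1) ((k + i)%:Z < t%:Z + L)%R%:R)) : A -> A)).

Lemma deg_geP t (v : A) :
  reflect (forall i : 'I_(n - k).+1, (k + i)%:Z < t%:Z + L -> v 0 i = 0)
          (v \in deg_ge t).
Proof.
rewrite memv_ker lfunE /= mul_mx_diag.
apply: (iffP eqP) => [/rowP v0 i lt_it | v0].
  by have := v0 i; rewrite !mxE lt_it mulr1.
apply/rowP=> i; rewrite !mxE.
by case: (boolP (_ < _)) => [/v0->|_]; rewrite ?mul0r ?mulr0.
Qed.

Lemma deg_ge_e t (p : int) : t%:Z + L <= p -> idd_e F k n p \in deg_ge t.
Proof.
move=> le_tp; apply/deg_geP=> i lt_it; rewrite /idd_e.
case: ifP => [/andP[kp pn] | _]; last by rewrite mxE.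
rewrite mxE eqxx /=; case: eqP => // def_i; move: lt_it.
rewrite def_i inordK; last by lia.
by lia.
Qed.

Lemma deg_ge_mul a b (u v : A) : u \in deg_ge a -> v \in deg_ge b ->
  idd_mul m1 m2 u v \in deg_ge (a + b).
Proof.
move=> /deg_geP u_a /deg_geP v_b.
apply: memv_suml => i _; apply: memv_suml => j _.
have [lt_ia | le_ai] := ltP (k + i)%:Z (a%:Z + L).
  by rewrite (u_a i lt_ia) mul0r scale0r mem0v.
have [lt_jb | le_bj] := ltP (k + j)%:Z (b%:Z + L).
  by rewrite (v_b j lt_jb) mulr0 scale0r mem0v.
by apply/memvZ/memvZ/deg_ge_e; lia.
Qed.

Lemma deg_ge1_full : L < k%:Z -> (fullv <= deg_ge 1)%VS.
Proof. by move=> lt_Lk; apply/subvP=> v _; apply/deg_geP=> i; lia. Qed.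

Lemma deg_ge_eq0 t : (k <= n)%N -> n%:Z - L < t%:Z -> deg_ge t = 0%VS.
Proof.
move=> le_kn lt_nt; apply/eqP; rewrite -subv0; apply/subvP=> v /deg_geP v0.
rewrite memv0; apply/eqP/rowP=> i; rewrite mxE; apply: v0.
by have := ltn_ord i; lia.
Qed.

Lemma idd_nilpotent :
  (k <= n)%N -> L < k%:Z -> nilpotent_alg (@idd_mul F k n m1 m2).
Proof.
move=> le_kn lt_Lk; pose t := `|n%:Z - L|.+1.
exists t; split=> //; apply/eqP; rewrite -subv0 -(@deg_ge_eq0 t) //; last first.
  by rewrite /t; lia.
apply: alg_power_sub_filtration => //; first exact: deg_ge1_full.
exact: deg_ge_mul.
Qed.

End ShiftedDegree.

Theorem proposition2p12 (R : realType) (k n : nat) (m1 m2 : int)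
    (hkn : (k <= n)%N) (hm : m2 <= m1)
    (hmul : nonzero_mul (@idd_mul R[i] k n m1 m2))
    (hlev1 : 2 * k%:Z - n%:Z <= m1 + m2)
    (hlev2 : m1 + m2 < k%:Z) :
  nilpotent_alg (@idd_mul R[i] k n m1 m2).
Proof. exact: idd_nilpotent. Qed.
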